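(* Let $A\in M_n(\mathbb{H})$ be a tridiagonal symmetric quaternion matrix. Then there exists a simple quaternion polynomial $p_n(A,z)$ of degree $n$ such that $$\sigma(A)=\{\alpha^{-1}\lambda\alpha:\ \alpha\in\mathbb{H}\setminus\{0\},\ \lambda\in Z_p\},$$ where $\sigma(A)$ is the right spectrum of $A$ and $Z_p\subset\mathbb{H}$ is the zero set of $p_n(A,z)$.
   Context: $\mathbb{H}$ is the skew field of real quaternions and $M_n(\mathbb{H})$ the set of $n\times n$ matrices over $\mathbb{H}$. Symmetric means $A^\top=A$ (transpose without conjugation). A quaternion $\lambda$ is a right eigenvalue of $A$ if $A\boldsymbol{\xi}=\boldsymbol{\xi}\lambda$ for some $\boldsymbol{\xi}\in\mathbb{H}^n\setminus\{0\}$; the right spectrum $\sigma(A)$ is the set of all right eigenvalues of $A$. A simple quaternion polynomial is a polynomial function $z\mapsto\sum_{k}c_kz^k$ on $\mathbb{H}$ whose quaternion coefficients $c_k$ are located only on the left of the powers of $z$. *)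

(* Defs.v *)
From HB Require Import structures.
From mathcomp Require Import all_boot all_order all_algebra ring.
From mathcomp Require Import classical_sets reals.

Set Implicit Arguments.
Unset Strict Implicit.
Unset Printing Implicit Defensive.

Import Order.TTheory GRing.Theory Num.Theory.
Local Open Scope classical_set_scope.
Local Open Scope ring_scope.

(* [Quat a b c d] stands for a + b i + c j + d k. *)
Record quat (R : realType) := Quat { qre : R; qi : R; qj : R; qk : R }.

Section QuaternionRing.
Variable R : realType.
Local Notation H := (quat R).

Definition tuple_of_quat (x : H) : R * R * R * R :=
  (qre x, qi x, qj x, qk x).
Definition quat_of_tuple (t : R * R * R * R) : H :=
  let: (a, b, c, d) := t in Quat a b c d.

Fact tuple_of_quatK : cancel tuple_of_quat quat_of_tuple.
Proof. by case. Qed.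

HB.instance Definition _ := Choice.copy H (can_type tuple_of_quatK).

Definition addq (x y : H) : H :=
  Quat (qre x + qre y) (qi x + qi y) (qj x + qj y) (qk x + qk y).
Definition oppq (x : H) : H := Quat (- qre x) (- qi x) (- qj x) (- qk x).
Definition zeroq : H := Quat 0 0 0 0.

Fact addqA : associative addq.
Proof. by move=> [????] [????] [????]; congr Quat; rewrite /= addrA. Qed.
Fact addqC : commutative addq.
Proof. by move=> [????] [????]; congr Quat; rewrite /= addrC. Qed.
Fact add0q : left_id zeroq addq.
Proof. by move=> [????]; congr Quat; rewrite /= add0r. Qed.
Fact addNq : left_inverse zeroq oppq addq.
Proof. by move=> [????]; congr Quat; rewrite /= addNr. Qed.

HB.instance Definition _ := GRing.isZmodule.Build H addqA addqC add0q addNq.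

Definition oneq : H := Quat 1 0 0 0.
Definition mulq (x y : H) : H :=
  let: Quat a b c d := x in let: Quat a' b' c' d' := y in
  Quat (a * a' - b * b' - c * c' - d * d')
       (a * b' + b * a' + c * d' - d * c')
       (a * c' - b * d' + c * a' + d * b')
       (a * d' + b * c' - c * b' + d * a').

Fact mulqA : associative mulq.
Proof. by move=> [????] [????] [????]; congr Quat; ring. Qed.
Fact mul1q : left_id oneq mulq.
Proof. by move=> [????]; congr Quat; ring. Qed.
Fact mulq1 : right_id oneq mulq.
Proof. by move=> [????]; congr Quat; ring. Qed.
Fact mulqDl : left_distributive mulq +%R.
Proof. by move=> [????] [????] [????]; congr Quat; rewrite /=; ring. Qed.
Fact mulqDr : right_distributive mulq +%R.
Proof. by move=> [????] [????] [????]; congr Quat; rewrite /=; ring. Qed.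
Fact oneq_neq0 : oneq != 0.
Proof. by apply/eqP => -[/eqP]; rewrite oner_eq0. Qed.

HB.instance Definition _ := GRing.Zmodule_isNzRing.Build H
  mulqA mul1q mulq1 mulqDl mulqDr oneq_neq0.

Definition sqnormq (x : H) : R :=
  qre x ^+ 2 + qi x ^+ 2 + qj x ^+ 2 + qk x ^+ 2.
Definition invq (x : H) : H :=
  Quat (qre x / sqnormq x) (- qi x / sqnormq x)
       (- qj x / sqnormq x) (- qk x / sqnormq x).

Fact sqnormq_eq0 (x : H) : (sqnormq x == 0) = (x == 0).
Proof.
apply/eqP/eqP => [|->]; last by rewrite /sqnormq /= expr0n /= !addr0.
case: x => a b c d; rewrite /sqnormq /= => h.
have sq0 (t u : R) : 0 <= u -> t ^+ 2 + u = 0 -> t = 0.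
  move=> u0 /eqP; rewrite paddr_eq0 ?sqr_ge0// sqrf_eq0.
  by case/andP=> /eqP.
by congr Quat; [apply: (sq0 _ (b ^+ 2 + c ^+ 2 + d ^+ 2))
  | apply: (sq0 _ (a ^+ 2 + c ^+ 2 + d ^+ 2))
  | apply: (sq0 _ (a ^+ 2 + b ^+ 2 + d ^+ 2))
  | apply: (sq0 _ (a ^+ 2 + b ^+ 2 + c ^+ 2))];
  rewrite ?addr_ge0 ?sqr_ge0 // -[RHS]h; ring.
Qed.

Fact mulVq : {in [pred x : H | x != 0], left_inverse 1 invq *%R}.
Proof.
move=> x; rewrite inE -sqnormq_eq0; case: x => a b c d.
by rewrite /sqnormq /= => h; congr Quat; rewrite /sqnormq /=; field.
Qed.
Fact divqq : {in [pred x : H | x != 0], right_inverse 1 invq *%R}.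
Proof.
move=> x; rewrite inE -sqnormq_eq0; case: x => a b c d.
by rewrite /sqnormq /= => h; congr Quat; rewrite /sqnormq /=; field.
Qed.
Fact unitqP (x y : H) : y * x = 1 /\ x * y = 1 -> x \in [pred x | x != 0].
Proof.
move=> [yx _]; rewrite inE; apply/eqP => x0.
by move: (oner_neq0 H); rewrite -yx x0 mulr0 eqxx.
Qed.
Fact invq_out : {in [predC [pred x : H | x != 0]], invq =1 id}.
Proof.
by move=> x; rewrite !inE negbK => /eqP ->; congr Quat;
  rewrite /= ?oppr0 mul0r.
Qed.

HB.instance Definition _ := GRing.NzRing_hasMulInverse.Build H
  mulVq divqq unitqP invq_out.

Lemma unitqE (x : H) : (x \is a GRing.unit) = (x != 0).
Proof. by []. Qed.

End QuaternionRing.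

(* [A^T] is the plain transpose, without conjugation of the entries. *)
Definition symmetric_mx (R : realType) (n : nat) (A : 'M[quat R]_n) : Prop :=
  A^T = A.

Definition tridiagonal_mx (R : realType) (n : nat) (A : 'M[quat R]_n) : Prop :=
  forall i j : 'I_n, (i.+1 < j)%N || (j.+1 < i)%N -> A i j = 0.

Definition right_eigenvalue (R : realType) (n : nat) (A : 'M[quat R]_n)
    (lambda : quat R) : Prop :=
  exists2 xi : 'cV[quat R]_n,
    xi != 0 & A *m xi = \col_(i < n) (xi i 0 * lambda).

Definition right_spectrum (R : realType) (n : nat) (A : 'M[quat R]_n) :
    set (quat R) :=
  [set lambda | right_eigenvalue A lambda].

(* Horner evaluation over a noncommutative ring keeps the coefficients on the
   left: [horner_coef] gives p.[z] = \sum_(k < size p) p`_k * z ^+ k, so an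
   element of [{poly quat R}] is evaluated as a simple quaternion polynomial. *)
Definition zero_set (R : realType) (p : {poly quat R}) : set (quat R) :=
  [set z | p.[z] = 0].

(* Main.v *)
(* When no superdiagonal entry of [A] vanishes, the rows of [A xi = xi z] with
   [xi_0 = 1] determine [xi_1, xi_2, ...] successively as simple polynomials in
   [z], and the last row says that one more such polynomial vanishes at [z];
   rescaling [xi] on the right conjugates the eigenvalue. When a superdiagonal
   entry vanishes, symmetry makes [A] block diagonal, and the product of the
   polynomials of the two blocks works: [(p * q).[z] = p.[w z w^-1] * w] with
   [w = q.[z]], and if [q] has no root in the class of a root [z'] of [p], then
   [z |-> q.[z] * z * q.[z]^-1] maps some element of that class to [z']. *)
Require Import Defs.
From mathcomp Require Import all_boot all_order all_algebra ring.
From mathcomp Require Import classical_sets reals.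

Import GRing.Theory.
Local Open Scope classical_set_scope.
Local Open Scope ring_scope.

(** * Roots of simple polynomials along conjugacy classes *)

Section QuaternionPolynomials.
Set Implicit Arguments.
Unset Strict Implicit.
Variable R : realType.
Local Notation H := (quat R).
Implicit Types (z w : H) (p q : {poly H}).

Definition conjq z : H := Quat (qre z) (- qi z) (- qj z) (- qk z).

Lemma addq_conj_central z w : (z + conjq z) * w = w * (z + conjq z).
Proof. by case: z w => [????] [????]; congr Quat; rewrite /=; ring. Qed.

Lemma mulq_conj_central z w : (z * conjq z) * w = w * (z * conjq z).
Proof. by case: z w => [????] [????]; congr Quat; rewrite /=; ring. Qed.

Lemma conjq_mulC z : conjq z * z = z * conjq z.
Proof. by case: z => [????]; congr Quat; rewrite /=; ring. Qed.

(** An imaginary [u] orthogonal to the imaginary part of [z] anticommutes with it: [i] if [z] lies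
    in the span of 1 and [k], else [c i - b j]. *)
Lemma conjq_conjugate z : exists2 u : H, u != 0 & u * z = conjq z * u.
Proof.
case: z => a b c d; have [/eqP|bc0] := boolP ((b == 0) && (c == 0)).
  move=> /eqP/andP[/eqP-> /eqP->]; exists (Quat 0 1 0 0).
    by apply/eqP => -[/eqP]; rewrite oner_eq0.
  by congr Quat; rewrite /=; ring.
exists (Quat 0 c (- b) 0); last by congr Quat; rewrite /=; ring.
by apply: contra bc0 => /eqP[-> /eqP]; rewrite oppr_eq0 eqxx andbT.
Qed.

(** Conjugates share the trace and norm of [z], which are real and hence central, so they satisfy
    the same quadratic. *)
Lemma quadratic_conjugate z (t : H) : t != 0 ->
  (t * z * t^-1) * (t * z * t^-1) =
  (z + conjq z) * (t * z * t^-1) - z * conjq z.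
Proof.
move=> t0; have tU : t \is a GRing.unit by rewrite unitqE.
have -> : t * z * t^-1 * (t * z * t^-1) = t * (z * z) * t^-1.
  by rewrite !mulrA mulrVK.
have -> : z * z = (z + conjq z) * z - z * conjq z.
  by rewrite mulrDl conjq_mulC addrK.
rewrite mulrBr mulrBl; congr (_ - _).
  by rewrite (mulrA t (z + _)) -addq_conj_central -!mulrA.
by rewrite -mulq_conj_central mulrK.
Qed.

(** The shared quadratic reduces every power to degree at most one, with the same coefficients
    throughout the class. *)
Lemma horner_conjugacy_class q z : exists a b : H, forall t, t != 0 ->
  q.[t * z * t^-1] = a + b * (t * z * t^-1).
Proof.
elim/poly_ind: q => [|q c [a [b IH]]].
  by exists 0, 0 => t _; rewrite horner0 mul0r addr0.
exists (c - b * (z * conjq z)), (a + b * (z + conjq z)) => t t0.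
rewrite hornerMXaddC IH //; have := quadratic_conjugate z t0.
move: (t * z * t^-1) => w ww.
rewrite mulrDl -mulrA ww mulrBr [b * (_ * w)]mulrA.
by rewrite [RHS]addrC mulrDl !addrA [LHS]addrAC.
Qed.

Lemma horner_mul_eq0 p q z : q.[z] = 0 -> (p * q).[z] = 0.
Proof.
move=> qz0; elim/poly_ind: p => [|p c IH]; first by rewrite mul0r horner0.
(* As ['X] is central, the product with [q] is [p * q * 'X + c%:P * q]. *)
rewrite mulrDl -mulrA -commr_polyX mulrA hornerD hornerMX hornerCM IH qz0.
by rewrite mul0r mulr0 addr0.
Qed.

Lemma horner_mul_conj p q z : q.[z] != 0 ->
  (p * q).[z] = p.[q.[z] * z * q.[z]^-1] * q.[z].
Proof.
move=> qz0; elim/poly_ind: p => [|p c IH].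
  by rewrite mul0r !horner0 mul0r.
rewrite mulrDl -mulrA -commr_polyX mulrA hornerD hornerMX hornerCM IH.
by rewrite hornerMXaddC mulrDl !mulrA mulrVK ?unitqE.
Qed.

(** Unlike being a root, this is invariant under conjugation of [z], as membership in the right
    spectrum is. *)
Definition class_root p z := exists2 t : H, t != 0 & p.[t * z * t^-1] = 0.

Lemma conjugateM (s t z : H) : s != 0 -> t != 0 ->
  s * (t * z * t^-1) * s^-1 = s * t * z * (s * t)^-1.
Proof. by move=> s0 t0; rewrite invrM ?unitqE// !mulrA. Qed.

Lemma mulq_neq0 (s t : H) : s != 0 -> t != 0 -> s * t != 0.
Proof. by rewrite -!unitqE => sU tU; rewrite unitrMl. Qed.

Lemma class_root_conj p z (t : H) : t != 0 ->
  class_root p (t * z * t^-1) <-> class_root p z.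
Proof.
move=> t0; split=> [[s s0 ps]|[s s0 ps]].
  by exists (s * t); rewrite ?mulq_neq0 // -conjugateM.
have ti0 : t^-1 != 0 by rewrite -unitqE unitrV.
exists (s * t^-1); rewrite ?mulq_neq0 // conjugateM ?mulq_neq0 //.
by rewrite mulrVK ?unitqE.
Qed.

(* On the class of [z] the polynomial [q] is an affine map [a + b * w], and
   [q.[w] * w = z * q.[w]] becomes [g * w = z * g] with [g = a + conjq z * b];
   when [g = 0], [q] vanishes in the class instead. *)
Lemma class_root_or_preimage q z : class_root q z \/
  exists2 t : H, t != 0 &
    let w := t * z * t^-1 in q.[w] != 0 /\ q.[w] * w = z * q.[w].
Proof.
have [a [b qE]] := horner_conjugacy_class q z.
pose g := a + conjq z * b.
have [g0|g0] := eqVneq g 0.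
  left; have [b0|b0] := eqVneq b 0.
    exists 1; rewrite ?oner_eq0 // qE ?oner_eq0 //.
    by move: g0; rewrite /g b0 mulr0 mul0r.
  have [u u0 uz] := conjq_conjugate z.
  have bi0 : b^-1 != 0 by rewrite -unitqE unitrV.
  (* Since [a = - conjq z * b], the affine map vanishes at [b^-1 * conjq z * b], which [uz] shows to
     be a conjugate of [z]. *)
  exists (b^-1 * u); rewrite ?mulq_neq0 // qE ?mulq_neq0 //.
  rewrite -conjugateM // uz mulrK ?unitqE // invrK !mulrA divrr ?unitqE //.
  by rewrite mul1r.
have gi0 : g^-1 != 0 by rewrite -unitqE unitrV.
have [qw0|qw0] := eqVneq q.[g^-1 * z * g^-1^-1] 0; first by left; exists g^-1.
right; exists g^-1 => //=; split=> //.
have gw : g * (g^-1 * z * g^-1^-1) = z * g.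
  by rewrite invrK !mulrA divrr ?unitqE // mul1r.
(* By the quadratic for [w], [q.[w] * w - z * q.[w]] collapses to [g * w - z * g]. *)
rewrite qE //; have := quadratic_conjugate z gi0.
move: (g^-1 * z * g^-1^-1) gw => w gw ww.
have -> : z * (a + b * w) = z * g + (z * (b * w) - z * conjq z * b).
  by rewrite /g !mulrDr !mulrA addrACA subrr addr0.
rewrite -gw /g [(a + _) * w]mulrDl [(a + b * w) * w]mulrDl -addrA.
congr (_ + _); rewrite -mulrA ww mulrBr -mulq_conj_central.
rewrite (mulrA b) -addq_conj_central !mulrDl addrA !mulrA.
by rewrite [conjq z * b * w + _]addrC.
Qed.

Lemma class_root_mul p q z :
  class_root (p * q) z <-> class_root p z \/ class_root q z.
Proof.
split=> [[t t0 pq0]|[[t t0 pt0]|[t t0 qt0]]].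
- have [q0|q0] := eqVneq q.[t * z * t^-1] 0; first by right; exists t.
  left; exists (q.[t * z * t^-1] * t); first exact: mulq_neq0.
  move: pq0; rewrite horner_mul_conj // conjugateM // => pq0.
  by rewrite -[LHS](@mulrK _ q.[t * z * t^-1]) ?unitqE // pq0 mul0r.
(* The preimage needed is that of the root of [p] itself, so the goal moves from [z] to that
   root. *)
- apply/(class_root_conj _ _ t0).
  have [[s s0 qs0]|[s s0 /= [qs0 qsE]]] :=
    class_root_or_preimage q (t * z * t^-1).
    by exists s => //; apply: horner_mul_eq0.
  exists s => //; rewrite horner_mul_conj // qsE mulrK ?unitqE //.
  by rewrite pt0 mul0r.
- by exists t => //; apply: horner_mul_eq0.
Qed.

Lemma size_mulq p q : p != 0 -> q != 0 -> size (p * q) = (size p + size q).-1.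
Proof.
move=> p0 q0; apply: size_proper_mul.
by rewrite mulq_neq0 // lead_coef_eq0.
Qed.

End QuaternionPolynomials.

(** * Recurrences given by the rows of a Hessenberg matrix *)

Section HessenbergRecurrence.
Set Implicit Arguments.
Unset Strict Implicit.
Variables (R : realType) (a : nat -> nat -> quat R).
Local Notation H := (quat R).
Hypothesis a_super : forall i, a i i.+1 != 0.

(** Row [i] determines the term of index [i.+1] from the earlier ones, because [a i i.+1] is
    invertible. *)
Lemma hessenberg_unique m (u v : nat -> H) (z : H) : u 0 = v 0 ->
    (forall i, (i < m)%N -> \sum_(j < i.+2) a i j * u j = u i * z) ->
    (forall i, (i < m)%N -> \sum_(j < i.+2) a i j * v j = v i * z) ->
  forall k, (k <= m)%N -> u k = v k.
Proof.
move=> uv0 uE vE; elim/ltn_ind => -[//|k] IH km.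
have := uE k km; rewrite (IH k (ltnSn k) (ltnW km)) -vE //.
rewrite big_ord_recr [RHS]big_ord_recr /=.
under eq_bigr => i _ do
  rewrite (IH i (ltn_ord i) (ltnW (leq_trans (ltn_ord i) km))).
by move/addrI/mulrI; apply; rewrite unitqE.
Qed.

Lemma hessenberg_polynomials m : exists q : nat -> {poly H},
  [/\ q 0 = 1, forall k, (k <= m)%N -> size (q k) = k.+1 &
      forall i, (i < m)%N ->
        q i * 'X = \sum_(j < i.+2) (a i j)%:P * q j].
Proof.
elim: m => [|m [q [q0 sq qE]]].
  by exists (fun=> 1); split=> // -[|//]; rewrite size_poly1.
(* [r] is what [a m m.+1] times the next polynomial must be; [q m * 'X] alone fixes its degree. *)
pose r := q m * 'X - \sum_(j < m.+1) (a m j)%:P * q j.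
have rE : q m * 'X = \sum_(j < m.+1) (a m j)%:P * q j + r.
  by rewrite addrC subrK.
have sr : size r = m.+2.
  have qm0 : q m != 0 by rewrite -size_poly_eq0 sq.
  rewrite /r size_polyDl size_mulX ?sq // size_polyN ltnS.
  apply: leq_trans (size_sum _ _ _) _; apply/bigmax_leqP => j _.
  rewrite mul_polyC; apply: leq_trans (size_scale_leq _ _) _.
  by have jm : (j <= m)%N := ltn_ord j; rewrite sq.
clearbody r.
pose q' k := if (k <= m)%N then q k else (a m m.+1)^-1 *: r.
have q'E k : (k <= m)%N -> q' k = q k by rewrite /q' => ->.
have q'S : q' m.+1 = (a m m.+1)^-1 *: r by rewrite /q' ltnn.
exists q'; split=> [|k|i]; first by rewrite q'E.
  rewrite leq_eqVlt ltnS => /orP[/eqP->|km]; last by rewrite q'E ?sq.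
  rewrite q'S -sr; apply/eqP; rewrite eqn_leq size_scale_leq /=.
  (* Scaling never increases the size, so undoing it gives the reverse inequality. *)
  have {1}-> : r = a m m.+1 *: ((a m m.+1)^-1 *: r).
    by rewrite scalerA divrr ?unitqE // scale1r.
  exact: size_scale_leq.
rewrite ltnS leq_eqVlt => /orP[/eqP->|im].
  rewrite big_ord_recr /= q'E // rE q'S mul_polyC scalerA divrr ?unitqE //.
  rewrite scale1r; congr (_ + _); apply: eq_bigr => j _.
  by rewrite q'E // -ltnS ltn_ord.
rewrite q'E 1?ltnW // qE //; apply: eq_bigr => j _.
by rewrite q'E // -ltnS (leq_trans (ltn_ord j)).
Qed.

End HessenbergRecurrence.

(** * Right eigenvalues of block, Hessenberg and tridiagonal matrices *)

Section Eigenvalues.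
Set Implicit Arguments.
Unset Strict Implicit.
Variable R : realType.
Local Notation H := (quat R).

(** With the right scalar as a 1 by 1 matrix factor, associativity of the matrix product applies. *)
Lemma right_eigenvalueP n (A : 'M[H]_n) (z : H) :
  right_eigenvalue A z <->
  exists2 xi : 'cV_n, xi != 0 & A *m xi = xi *m z%:M.
Proof.
have E (xi : 'cV[H]_n) : \col_i (xi i 0 * z) = xi *m z%:M.
  by apply/colP => i; rewrite !mxE big_ord1 mxE mulr1n.
by split=> -[xi xi0 Axi]; exists xi; rewrite // Axi E.
Qed.

Lemma right_eigenvalue_conj n (A : 'M[H]_n) (z t : H) : t != 0 ->
  right_eigenvalue A z -> right_eigenvalue A (t * z * t^-1).
Proof.
move=> t0 /right_eigenvalueP[xi xi0 Axi]; apply/right_eigenvalueP.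
have tU : t \is a GRing.unit by rewrite unitqE.
exists (xi *m (t^-1)%:M).
  apply: contra xi0 => /eqP xit0.
  by rewrite -[xi]mulmx1 -(mulVr tU) scalar_mxM mulmxA xit0 mul0mx.
by rewrite mulmxA Axi -!mulmxA -!scalar_mxM !mulrA mulVr // mul1r.
Qed.

Lemma right_eigenvalue_block m k (B : 'M[H]_m) (C : 'M[H]_k) (z : H) :
  right_eigenvalue (block_mx B 0 0 C) z <->
  right_eigenvalue B z \/ right_eigenvalue C z.
Proof.
split=> [/right_eigenvalueP[xi]|].
  rewrite -[xi]vsubmxK mul_block_col mul_col_mx !mul0mx addr0 add0r.
  rewrite col_mx_eq0 negb_and => xi0 /eq_col_mx[Bu Cv].
  by case/orP: xi0 => [u0|v0]; [left|right]; apply/right_eigenvalueP;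
    [exists (usubmx xi)|exists (dsubmx xi)].
case=> /right_eigenvalueP[u u0 uE]; apply/right_eigenvalueP.
  exists (col_mx u 0); first by rewrite col_mx_eq0 negb_and u0.
  by rewrite mul_block_col mul_col_mx uE !mul0mx mulmx0 !addr0.
exists (col_mx 0 u); first by rewrite col_mx_eq0 negb_and u0 orbT.
by rewrite mul_block_col mul_col_mx uE !mul0mx mulmx0 !add0r.
Qed.

Lemma right_eigenvalue_hessenberg n (A : 'M[H]_n.+1) :
    (forall i j : 'I_n.+1, (i.+1 < j)%N -> A i j = 0) ->
    (forall i j : 'I_n.+1, j = i.+1 :> nat -> A i j != 0) ->
  exists2 p : {poly H}, size p = n.+2 &
    forall z, right_eigenvalue A z <-> class_root p z.
Proof.
move=> A0 A1.
(* The padding adds a term [y n.+1] with coefficient 1 to the last row, so the last eigenvalue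
   equation amounts to [y n.+1 = 0], and [q n.+1] is the polynomial sought. *)
pose a i j := if (i <= n)%N && (j <= n)%N then A (inord i) (inord j)
              else (j == i.+1)%:R.
have aA (i j : 'I_n.+1) : a i j = A i j.
  by rewrite /a !leq_ord !inord_val.
have a1 i : a i i.+1 != 0.
  rewrite /a eqxx; case: ifP => [/andP[hi hj]|_]; last exact: oner_neq0.
  by apply: A1; rewrite !inordK.
have rowE (y : nat -> H) (i : 'I_n.+1) : y n.+1 = 0 ->
    \sum_(j < i.+2) a i j * y j = \sum_j A i j * y j.
  move=> yn; transitivity (\sum_(j < n.+2) a i j * y j).
    rewrite -!(big_mkord xpredT (fun j => a i j * y j)).
    rewrite [RHS](big_cat_nat (n := i.+2)) //= ?ltnS ?leq_ord //.
    rewrite [X in _ + X]big_nat_cond [X in _ + X]big1 ?addr0 // => j.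
    rewrite andbT => /andP[ij jn]; rewrite /a.
    case: ifP => [/andP[hi hj]|_]; first by rewrite A0 ?mul0r // !inordK.
    by rewrite gtn_eqF // mul0r.
  rewrite big_ord_recr /= yn mulr0 addr0.
  by apply: eq_bigr => j _; rewrite aA.
have [q [q0 sq qE]] := hessenberg_polynomials a1 n.+1.
have qzE z i : (i < n.+1)%N ->
    \sum_(j < i.+2) a i j * (q j).[z] = (q i).[z] * z.
  move=> hi; rewrite -hornerMX qE // horner_sum.
  by apply: eq_bigr => j _; rewrite hornerCM.
exists (q n.+1) => [|z]; first exact: sq.
split=> [[xi xi0 /colP Axi]|[t t0 qz0]].
  pose y k := if (k <= n)%N then xi (inord k) 0 else 0.
  have yxi (i : 'I_n.+1) : y i = xi i 0 by rewrite /y leq_ord inord_val.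
  have yn : y n.+1 = 0 by rewrite /y ltnn.
  have yE i : (i < n.+1)%N -> \sum_(j < i.+2) a i j * y j = y i * z.
    move=> hi; rewrite (rowE y (Ordinal hi) yn) (yxi (Ordinal hi)).
    have := Axi (Ordinal hi); rewrite !mxE => <-.
    by apply: eq_bigr => j _; rewrite yxi.
  (* If [y 0] vanished, [y] would agree with the zero sequence, which obeys the same recurrence, and
     [xi] would be zero. *)
  have y0 : y 0 != 0.
    apply: contra xi0 => /eqP y0; apply/eqP/colP => i; rewrite mxE -yxi.
    apply: (hessenberg_unique a1 (v := fun=> 0) y0 yE) => [k _|].
      by rewrite mul0r big1 // => j _; rewrite mulr0.
    exact: ltnW.
  (* Right multiplication by [(y 0)^-1] makes the first entry [q 0 = 1] and turns the eigenvalue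
     into [w], so uniqueness applies. *)
  exists (y 0) => //; set w := _ * z * _.
  have /= <- : y n.+1 * (y 0)^-1 = (q n.+1).[w].
    apply: (hessenberg_unique a1 (m := n.+1) (u := fun k => y k * (y 0)^-1)
      (v := fun k => (q k).[w]) (z := w)) => //.
    - by rewrite divrr ?unitqE // q0 hornerC.
    - move=> i hi; under eq_bigr => j _ do rewrite mulrA.
      by rewrite -mulr_suml yE // /w !mulrA mulrVK ?unitqE.
    - exact: qzE.
  by rewrite yn mul0r.
suff: right_eigenvalue A (t * z * t^-1).
  have ti0 : t^-1 != 0 by rewrite -unitqE unitrV.
  move/(right_eigenvalue_conj ti0).
  by rewrite conjugateM // mulVr ?unitqE // invr1 mul1r mulr1.
exists (\col_i (q i).[t * z * t^-1]).
  apply/eqP => /colP/(_ 0); rewrite !mxE q0 hornerC => /eqP.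
  by rewrite oner_eq0.
apply/colP => i; rewrite !mxE -qzE //.
rewrite (rowE (fun k => (q k).[t * z * t^-1])) //.
by apply: eq_bigr => j _; rewrite mxE.
Qed.

(** Tridiagonality leaves only the bottom left corner of the upper right block, which is [A i j];
    symmetry then clears the lower left block. *)
Lemma tridiagonal_symmetric_split m k (A : 'M[H]_(m + k)) (i j : 'I_(m + k)) :
    tridiagonal_mx A -> symmetric_mx A ->
    i.+1 = m -> j = m :> nat -> A i j = 0 ->
  A = block_mx (ulsubmx A) 0 0 (drsubmx A).
Proof.
move=> Atri Asym im jm Aij; rewrite -{1}[A]submxK.
have ur0 : ursubmx A = 0.
  apply/matrixP => x y; rewrite !mxE.
  have [xm|xm] := ltnP x.+1 m.
    by apply: Atri; rewrite /= ltn_addr.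
  have xE : x.+1 = m by apply/eqP; rewrite eqn_leq xm ltn_ord.
  case: (posnP y) => [y0|y0]; last first.
    by apply: Atri; rewrite /= xE -[X in (X < _)%N]addn0 ltn_add2l y0.
  rewrite -[RHS]Aij; congr (A _ _); apply: val_inj => /=.
    by apply: succn_inj; rewrite xE.
  by rewrite y0 addn0.
by congr block_mx; rewrite // -{1}[A]Asym -trmx_ursub ur0 trmx0.
Qed.

Lemma right_eigenvalue_tridiagonal n (A : 'M[H]_n) :
    tridiagonal_mx A -> symmetric_mx A ->
  exists2 p : {poly H}, size p = n.+1 &
    forall z, right_eigenvalue A z <-> class_root p z.
Proof.
elim/ltn_ind: n A => n IH A Atri Asym.
have [/existsP[i /existsP[j /andP[/eqP ji /eqP Aij]]]|noz] :=
  boolP [exists i : 'I_n, exists j : 'I_n, (j == i.+1 :> nat) && (A i j == 0)].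
  (* Cutting just after row [i] leaves two nonempty blocks, both smaller than [n]. *)
  have [m [k [nE im]]] : exists m k, n = (m + k)%N /\ i.+1 = m.
    by exists i.+1, (n - i.+1)%N; rewrite subnKC.
  subst n; rewrite im in ji.
  have AE := tridiagonal_symmetric_split Atri Asym im ji Aij.
  have Asym' x y : A x y = A y x by rewrite -{1}Asym mxE.
  have m_lt : (m < m + k)%N by have := ltn_ord j; rewrite ji.
  have ul_tri : tridiagonal_mx (ulsubmx A).
    by move=> x y xy; rewrite !mxE; apply: Atri.
  have ul_sym : symmetric_mx (ulsubmx A).
    by apply/matrixP => x y; rewrite !mxE Asym'.
  have k_lt : (k < m + k)%N by rewrite -im ltnS leq_addl.
  have dr_tri : tridiagonal_mx (drsubmx A).
    by move=> x y xy; rewrite !mxE; apply: Atri; rewrite /= -!addnS !leq_add2l.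
  have dr_sym : symmetric_mx (drsubmx A).
    by apply/matrixP => x y; rewrite !mxE Asym'.
  have [p sp pE] := IH m m_lt _ ul_tri ul_sym.
  have [q sq qE] := IH k k_lt _ dr_tri dr_sym.
  exists (p * q) => [|z].
    have p0 : p != 0 by rewrite -size_poly_eq0 sp.
    have q0 : q != 0 by rewrite -size_poly_eq0 sq.
    by rewrite size_mulq // sp sq addnS.
  rewrite AE class_root_mul; split.
    by case/right_eigenvalue_block => [/pE|/qE]; [left|right].
  by case=> [/pE|/qE] h; apply/right_eigenvalue_block; [left|right].
case: n {IH} => [|n] in A Atri Asym noz *.
  (* In size 0 there is no nonzero column, and the constant 1 has no root. *)
  exists 1; first exact: size_poly1.
  move=> z; split=> [[xi /eqP[]]|[t _ /eqP]]; first by apply/colP => -[].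
  by rewrite hornerC oner_eq0.
apply: right_eigenvalue_hessenberg => [i j ij|i j ji].
  by apply: Atri; rewrite ij.
apply: contra noz => Aij; apply/existsP; exists i; apply/existsP; exists j.
by rewrite ji eqxx.
Qed.

End Eigenvalues.

Theorem theorem4p1 (R : realType) (n : nat) (A : 'M[quat R]_n)
    (Atri : tridiagonal_mx A) (Asym : symmetric_mx A) :
  exists p : {poly quat R},
    size p = n.+1 /\
    right_spectrum A =
      [set alpha^-1 * lambda * alpha |
        alpha in [set a : quat R | a != 0] & lambda in zero_set p].
Proof.
have [p sp pE] := right_eigenvalue_tridiagonal Atri Asym.
exists p; split=> //; apply/seteqP; split=> z /=.
  move=> /pE[t t0 pz]; exists t => //; exists (t * z * t^-1) => //.
  by rewrite !mulrA mulVr ?unitqE // mul1r mulrVK ?unitqE.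
move=> [t t0 [w pw <-]]; apply/pE; exists t => //.
by rewrite !mulrA divrr ?unitqE // mul1r mulrK ?unitqE.
Qed.
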